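(* Let $\lambda_0,\lambda_1>0$, $\Delta s\in\mathbb{R}\setminus\{0\}$, $m\in\mathbb{R}$ and put $\rho=m\,\Delta s$ (not assumed positive). Consider the system, for unknown reals $|\xi_0|,|\xi_1|\ge 0$, $\psi\ge 0$ and an unknown integer $n\in\mathbb{Z}$, $$\frac{1}{\Delta s^2}\Big(\frac{\psi^2}{\lambda_0\lambda_1}-1\Big)\Big(\frac{\lambda_0}{\lambda_1}+\frac{\lambda_1}{\lambda_0}\Big)\psi=(-1)^n|\xi_0||\xi_1|-\frac12\Big(\frac{|\xi_0|^2}{\lambda_1}+\frac{|\xi_1|^2}{\lambda_0}\Big)\psi,$$ $$\frac12\Big(\frac{\psi^2}{\lambda_1}+\lambda_0(1-\rho^2)\Big)|\xi_0|+(-1)^{n+1}\psi|\xi_1|=0,$$ $$(-1)^{n+1}\psi|\xi_0|+\frac12\Big(\frac{\psi^2}{\lambda_0}+\lambda_1(1-\rho^2)\Big)|\xi_1|=0,$$ subject to the condition $$\psi^2=\lambda_0\lambda_1(\rho+1)^2\quad\text{or}\quad \psi^2=\lambda_0\lambda_1(\rho-1)^2 .$$ This system possesses a nondegenerate solution (i.e. one with $|\xi_0||\xi_1|\neq 0$) if and only if $\rho=0$ or $1<|\rho|<2$. If $|\rho|=1$ or $|\rho|=2$, every solution is degenerate (i.e. $|\xi_0||\xi_1|=0$), and for all the remaining $\rho\in\mathbb{R}$ there is no solution.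
   Context: The three displayed equations are the (real form of the) Euler-Lagrange equations of the action $$S=(\lambda_0^2+\lambda_1^2)\,|\phi_{10}-\phi_{01}+i\phi_{01}\phi_{10}\Delta s^2|^2+\lambda_0\Big|\tfrac{1}{\Delta s}(\xi_1-\xi_0)+i\phi_{01}\Delta s\,\xi_1\Big|^2+\lambda_1\Big|\tfrac1{\Delta s}(\xi_1-\xi_0)+i\phi_{10}\Delta s\,\xi_0\Big|^2-m^2(\lambda_0|\xi_0|^2+\lambda_1|\xi_1|^2)$$ of a field $\xi=(\xi_0,\xi_1)\in\mathbb{C}^2$ and a connection with coefficients $\phi_{01},\phi_{10}\in\mathbb{C}$ on a two-point space (dipole), where with $\psi_{01}=1+i\phi_{01}\Delta s^2$, $\psi_{10}=1-i\phi_{10}\Delta s^2$ the connection is required to satisfy $\lambda_0\psi_{01}=\lambda_1\overline{\psi_{10}}$. One writes $\xi_j=|\xi_j|e^{i\alpha_j}$, $\psi_{01}=|\psi_{01}|e^{i\gamma}$, $\psi=\lambda_0|\psi_{01}|=\lambda_1|\psi_{10}|$, and $n$ is the integer with $\alpha_1-\alpha_0+\gamma=n\pi$. The condition $\psi^2=\lambda_0\lambda_1(\rho\pm1)^2$ expresses the vanishing of the determinant of the last two (linear in $|\xi_0|,|\xi_1|$) equations; it is automatic for nondegenerate solutions. *)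

(* Defs.v *)
From Stdlib Require Import Reals ZArith.

Open Scope R_scope.

(* The unknowns are [x0 = |xi_0|], [x1 = |xi_1|], [psi] and [n]; the couplings
   are [l0 = lambda_0], [l1 = lambda_1], [ds = Delta s] and [rho = m Delta s]. *)

Definition eq_connection (l0 l1 ds x0 x1 psi : R) (n : Z) : Prop :=
  1 / ds ^ 2 * (psi ^ 2 / (l0 * l1) - 1) * (l0 / l1 + l1 / l0) * psi
  = powerRZ (-1) n * x0 * x1 - 1 / 2 * (x0 ^ 2 / l1 + x1 ^ 2 / l0) * psi.

Definition eq_field0 (l0 l1 rho x0 x1 psi : R) (n : Z) : Prop :=
  1 / 2 * (psi ^ 2 / l1 + l0 * (1 - rho ^ 2)) * x0
  + powerRZ (-1) (n + 1) * psi * x1 = 0.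

Definition eq_field1 (l0 l1 rho x0 x1 psi : R) (n : Z) : Prop :=
  powerRZ (-1) (n + 1) * psi * x0
  + 1 / 2 * (psi ^ 2 / l0 + l1 * (1 - rho ^ 2)) * x1 = 0.

(* Part of the notion of solution: for [x0 = x1 = 0] it does not follow from
   the three equations. *)
Definition det_condition (l0 l1 rho psi : R) : Prop :=
  psi ^ 2 = l0 * l1 * (rho + 1) ^ 2 \/ psi ^ 2 = l0 * l1 * (rho - 1) ^ 2.

Record is_solution (l0 l1 ds rho x0 x1 psi : R) (n : Z) : Prop := {
  sol_x0_ge0 : 0 <= x0;
  sol_x1_ge0 : 0 <= x1;
  sol_psi_ge0 : 0 <= psi;
  sol_connection : eq_connection l0 l1 ds x0 x1 psi n;
  sol_field0 : eq_field0 l0 l1 rho x0 x1 psi n;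
  sol_field1 : eq_field1 l0 l1 rho x0 x1 psi n;
  sol_det : det_condition l0 l1 rho psi
}.

Definition degenerate (x0 x1 : R) : Prop := x0 * x1 = 0.

(* Main.v *)
(** Put [u = sqrt l0 * x0], [v = sqrt l1 * x1], [s = (-1)^n], and let [e = 1] or
    [e = -1] be the sign in the determinant condition. With [t = 1 + e rho] that
    condition reads [psi = sqrt (l0 l1) |t|], and the system becomes
    [K (t^2 - 1) |t| = s u v - (u^2 + v^2) |t| / 2], [t u = s |t| v],
    [t v = s |t| u] with [K > 0]. If [t = 0] the first equation gives [u v = 0].
    If [t <> 0] then [u = v], and either [u = 0], which forces [|t| = 1], or
    [s = t / |t|] and [K (t^2 - 1) |t| = u^2 (s - |t|)], which is solvable with
    [u <> 0] exactly for [t = 1] and for [-1 < t < 0]. *)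
Require Import Defs.
From Stdlib Require Import Reals ZArith Lra.
Open Scope R_scope.

Definition reduced (K t s u v : R) : Prop :=
  K * (t ^ 2 - 1) * Rabs t = s * u * v - (u ^ 2 + v ^ 2) / 2 * Rabs t
  /\ t * u = s * Rabs t * v
  /\ t * v = s * Rabs t * u.

Lemma powerRZ_m1_cases (n : Z) : powerRZ (-1) n = 1 \/ powerRZ (-1) n = -1.
Proof.
assert (H : forall k : nat, (-1) ^ k = 1 \/ (-1) ^ k = -1).
{ intros k; induction k as [|k [IH|IH]]; simpl; try rewrite IH; lra. }
destruct n as [|p|p]; simpl.
- now left.
- apply H.
- destruct (H (Pos.to_nat p)) as [E|E]; rewrite E; [left|right]; field.
Qed.

(** Since [s * Rabs t] is [t] or [-t], both linear equations collapse to [t * (u - v) = 0] or to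
    [t * (u + v) = 0]. The latter, with [u] and [v] nonnegative, forces both to vanish. *)
Lemma reduced_same_sign (K t s u v : R) :
  s = 1 \/ s = -1 -> 0 <= u -> 0 <= v -> t <> 0 -> reduced K t s u v ->
  u = v /\ (u = 0 \/ s * Rabs t = t).
Proof.
intros Hs Hu Hv Ht [_ [H1 H2]].
destruct (Rcase_abs t) as [Hn|Hp].
- rewrite (Rabs_left t Hn) in *.
  destruct Hs as [-> | ->].
  + assert (E : t * (u + v) = 0) by lra.
    destruct (Rmult_integral _ _ E); lra.
  + assert (E : t * (u - v) = 0) by lra.
    destruct (Rmult_integral _ _ E); lra.
- rewrite (Rabs_right t Hp) in *.
  destruct Hs as [-> | ->].
  + assert (E : t * (u - v) = 0) by lra.
    destruct (Rmult_integral _ _ E); lra.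
  + assert (E : t * (u + v) = 0) by lra.
    destruct (Rmult_integral _ _ E); lra.
Qed.

(** Once [u = v] and [s * Rabs t = t], a factor [t - 1] splits off the first equation. For [t < 0]
    the cofactor gives [u * u = K * (1 + t) * - t], positive only if [-1 < t]; for [t > 0] the
    cofactor is positive, so [t = 1]. *)
Lemma reduced_nondegenerate (K t s u v : R) :
  0 < K -> s = 1 \/ s = -1 -> 0 <= u -> 0 <= v -> u * v <> 0 ->
  reduced K t s u v -> t = 1 \/ -1 < t < 0.
Proof.
intros HK Hs Hu Hv Huv H.
destruct (Req_dec t 0) as [->|Ht].
{ destruct H as [H _]. rewrite Rabs_R0 in H.
  exfalso; apply Huv. destruct Hs as [-> | ->]; lra. }
destruct (reduced_same_sign _ _ _ _ _ Hs Hu Hv Ht H) as [<- [H0|E]].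
{ exfalso; apply Huv; rewrite H0; ring. }
destruct H as [H _].
assert (Hu2 : 0 < u * u) by nra.
destruct (Rcase_abs t) as [Hn|Hp].
- right; split; [|exact Hn].
  rewrite (Rabs_left t Hn) in *.
  destruct Hs as [-> | ->]; [lra|].
  assert (F : (1 - t) * (u * u - K * (1 + t) * - t) = 0) by nra.
  apply Rmult_integral in F. destruct F as [F|F]; [lra|].
  destruct (Rlt_dec (-1) t) as [|G]; [assumption|].
  assert (0 <= K * - (1 + t) * - t)
    by (apply Rmult_le_pos; [apply Rmult_le_pos|]; lra).
  lra.
- left.
  rewrite (Rabs_right t Hp) in *.
  destruct Hs as [-> | ->]; [|lra].
  assert (F : (t - 1) * (u * u + K * (1 + t) * t) = 0) by nra.
  apply Rmult_integral in F. destruct F as [F|F]; [lra|].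
  assert (0 <= K * (1 + t) * t)
    by (apply Rmult_le_pos; [apply Rmult_le_pos|]; lra).
  lra.
Qed.

(** For [t <> 0] both unknowns vanish, and the first equation leaves only its left side,
    [K * (t ^ 2 - 1) * Rabs t = 0]. *)
Lemma reduced_degenerate (K t s u v : R) :
  0 < K -> s = 1 \/ s = -1 -> 0 <= u -> 0 <= v -> u * v = 0 ->
  reduced K t s u v -> t = 0 \/ t = 1 \/ t = -1.
Proof.
intros HK Hs Hu Hv Huv H.
destruct (Req_dec t 0) as [|Ht]; [now left|right].
destruct (reduced_same_sign _ _ _ _ _ Hs Hu Hv Ht H) as [<- _].
assert (u = 0) as -> by (destruct (Rmult_integral _ _ Huv); assumption).
destruct H as [H _].
assert (F : K * (t ^ 2 - 1) * Rabs t = 0) by lra.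
apply Rmult_integral in F. destruct F as [F|F].
- apply Rmult_integral in F. destruct F as [F|F]; [lra|].
  assert (G : (t - 1) * (t + 1) = 0) by lra.
  destruct (Rmult_integral _ _ G); lra.
- now apply Rabs_no_R0 in Ht.
Qed.

Lemma reduced_exists (K t : R) :
  0 < K -> t = 1 \/ -1 < t < 0 ->
  exists (n : Z) (u : R), 0 < u /\ reduced K t (powerRZ (-1) n) u u.
Proof.
intros HK [->|Ht].
(* At [t = 1], [s = 1] the first equation reads [0 = 0] whenever [u = v], so any positive [u] would
   do. *)
- exists 0%Z, 1. unfold reduced; rewrite Rabs_R1; simpl; lra.
- assert (P : 0 < K * (1 + t) * - t)
    by (apply Rmult_lt_0_compat; [apply Rmult_lt_0_compat|]; lra).
  (* An odd [n] gives [s = -1], the sign of [t]; the first equation then dictates the value of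
     [u ^ 2]. *)
  exists 1%Z, (sqrt (K * (1 + t) * - t)); split; [now apply sqrt_lt_R0|].
  assert (Q := sqrt_sqrt _ (Rlt_le _ _ P)).
  set (u := sqrt _) in *.
  unfold reduced; rewrite (Rabs_left t) by lra; rewrite powerRZ_1.
  repeat split; nra.
Qed.

Lemma Rabs_mult_sqr_eq (c psi t : R) :
  0 <= c -> 0 <= psi -> psi ^ 2 = c ^ 2 * t ^ 2 <-> psi = c * Rabs t.
Proof.
intros Hc Hpsi; split; intros H.
- rewrite <- (Rabs_right psi), <- (Rabs_right c), <- Rabs_mult by lra.
  apply Rsqr_eq_abs_0; unfold Rsqr; lra.
- rewrite H, Rpow_mult_distr, pow2_abs; reflexivity.
Qed.

Lemma det_condition_iff (a b rho psi : R) :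
  0 < a -> 0 < b -> 0 <= psi ->
  det_condition (a ^ 2) (b ^ 2) rho psi <->
  exists e, (e = 1 \/ e = -1) /\ psi = a * b * Rabs (1 + e * rho).
Proof.
intros Ha Hb Hpsi.
assert (Hab : 0 <= a * b) by (apply Rmult_le_pos; lra).
unfold det_condition; split.
- intros [H|H]; [exists 1|exists (-1)]; (split; [auto|]);
    apply Rabs_mult_sqr_eq; trivial; rewrite H; ring.
- intros [e [[-> | ->] H]]; [left|right];
    apply Rabs_mult_sqr_eq in H; trivial; rewrite H; ring.
Qed.

(** The three equations are multiplied by [a * b], [/ a] and [/ b] respectively. Writing the
    couplings as squares keeps everything rational in [a] and [b]. *)
Lemma equations_reduced (a b ds rho e x0 x1 : R) (n : Z) :
  0 < a -> 0 < b -> ds <> 0 -> e = 1 \/ e = -1 ->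
  let psi := a * b * Rabs (1 + e * rho) in
  (eq_connection (a ^ 2) (b ^ 2) ds x0 x1 psi n
   /\ eq_field0 (a ^ 2) (b ^ 2) rho x0 x1 psi n
   /\ eq_field1 (a ^ 2) (b ^ 2) rho x0 x1 psi n) <->
  reduced ((a ^ 4 + b ^ 4) / ds ^ 2) (1 + e * rho) (powerRZ (-1) n)
    (a * x0) (b * x1).
Proof.
intros Ha Hb Hds He.
unfold eq_connection, eq_field0, eq_field1, reduced; cbv zeta.
rewrite powerRZ_add, powerRZ_1 by lra.
set (s := powerRZ (-1) n).
(* This uses [e ^ 2 = 1]. In the field equations the square on the right cancels against the
   [psi ^ 2] term, leaving a coefficient linear in [t]. *)
assert (Hr : 1 - rho ^ 2 = 2 * (1 + e * rho) - (1 + e * rho) ^ 2)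
  by (destruct He as [-> | ->]; ring).
rewrite Hr; clear Hr He.
set (t := 1 + e * rho). clearbody s t.
assert (Hw : t ^ 2 = Rabs t ^ 2) by (symmetry; apply pow2_abs).
(* With every [t ^ 2] turned into [w ^ 2], the remaining identities hold for independent [t] and
   [w], so [field] can prove them. *)
rewrite Hw.
set (w := Rabs t) in *. clearbody w.
assert (a <> 0) by lra. assert (b <> 0) by lra.
assert (Hscale : forall c x y x' y' : R, c <> 0 ->
          c * (x - y) = x' - y' -> (x = y <-> x' = y')).
{ intros c x y x' y' Hc E; split; intros F.
  - apply Rminus_diag_uniq; rewrite <- E, F; ring.
  - apply Rminus_diag_uniq, (Rmult_eq_reg_l c); trivial.
    rewrite E, F; ring. }
assert (E1 := Hscale (a * b)
  (1 / ds ^ 2 * ((a * b * w) ^ 2 / (a ^ 2 * b ^ 2) - 1)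
     * (a ^ 2 / b ^ 2 + b ^ 2 / a ^ 2) * (a * b * w))
  (s * x0 * x1 - 1 / 2 * (x0 ^ 2 / b ^ 2 + x1 ^ 2 / a ^ 2) * (a * b * w))
  ((a ^ 4 + b ^ 4) / ds ^ 2 * (w ^ 2 - 1) * w)
  (s * (a * x0) * (b * x1) - ((a * x0) ^ 2 + (b * x1) ^ 2) / 2 * w)).
assert (E2 := Hscale (/ a)
  (1 / 2 * ((a * b * w) ^ 2 / b ^ 2 + a ^ 2 * (2 * t - w ^ 2)) * x0
     + s * -1 * (a * b * w) * x1) 0
  (t * (a * x0)) (s * w * (b * x1))).
assert (E3 := Hscale (/ b)
  (s * -1 * (a * b * w) * x0
     + 1 / 2 * ((a * b * w) ^ 2 / a ^ 2 + b ^ 2 * (2 * t - w ^ 2)) * x1) 0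
  (t * (b * x1)) (s * w * (a * x0))).
rewrite E1, E2, E3; try tauto; try (field; auto).
- now apply Rinv_neq_0_compat.
- now apply Rinv_neq_0_compat.
- now apply Rmult_integral_contrapositive_currified.
Qed.

Lemma solution_reduced (a b ds rho x0 x1 psi : R) (n : Z) :
  0 < a -> 0 < b -> ds <> 0 ->
  is_solution (a ^ 2) (b ^ 2) ds rho x0 x1 psi n <->
  0 <= x0 /\ 0 <= x1 /\
  exists e, (e = 1 \/ e = -1) /\ psi = a * b * Rabs (1 + e * rho) /\
    reduced ((a ^ 4 + b ^ 4) / ds ^ 2) (1 + e * rho) (powerRZ (-1) n)
      (a * x0) (b * x1).
Proof.
intros Ha Hb Hds; split.
- intros [h0 h1 hp hc hf0 hf1 hd]; do 2 (split; [assumption|]).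
  apply det_condition_iff in hd; trivial. destruct hd as [e [He ->]].
  exists e; split; [|split]; trivial.
  now apply equations_reduced.
- intros [h0 [h1 [e [He [-> H]]]]].
  apply equations_reduced in H; trivial. destruct H as [hc [hf0 hf1]].
  assert (hp : 0 <= a * b * Rabs (1 + e * rho)).
  { apply Rmult_le_pos; [apply Rmult_le_pos; lra|apply Rabs_pos]. }
  constructor; trivial.
  apply det_condition_iff; trivial. now exists e.
Qed.

Theorem theorem5p1 (l0 l1 ds m rho : R)
  (Hl0 : 0 < l0) (Hl1 : 0 < l1) (Hds : ds <> 0) (Hrho : rho = m * ds) :
  ((exists (x0 x1 psi : R) (n : Z),
      is_solution l0 l1 ds rho x0 x1 psi n /\ ~ degenerate x0 x1)
   <-> (rho = 0 \/ 1 < Rabs rho < 2))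
  /\ (Rabs rho = 1 \/ Rabs rho = 2 ->
      forall (x0 x1 psi : R) (n : Z),
        is_solution l0 l1 ds rho x0 x1 psi n -> degenerate x0 x1)
  /\ (~ (rho = 0 \/ 1 < Rabs rho < 2 \/ Rabs rho = 1 \/ Rabs rho = 2) ->
      ~ exists (x0 x1 psi : R) (n : Z), is_solution l0 l1 ds rho x0 x1 psi n).
Proof.
clear m Hrho.
assert (Ha := sqrt_lt_R0 _ Hl0). assert (Hb := sqrt_lt_R0 _ Hl1).
rewrite <- (pow2_sqrt l0), <- (pow2_sqrt l1) by lra.
set (a := sqrt l0) in *. set (b := sqrt l1) in *. clearbody a b.
clear l0 l1 Hl0 Hl1.
assert (HK : 0 < (a ^ 4 + b ^ 4) / ds ^ 2).
{ apply Rdiv_lt_0_compat.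
  - apply Rplus_lt_0_compat; now apply pow_lt.
  - rewrite <- Rsqr_pow2; now apply Rsqr_pos_lt. }
assert (Hnondeg : forall x0 x1 psi n,
  is_solution (a ^ 2) (b ^ 2) ds rho x0 x1 psi n -> ~ degenerate x0 x1 ->
  rho = 0 \/ 1 < Rabs rho < 2).
{ intros x0 x1 psi n H Hd.
  apply solution_reduced in H; trivial.
  destruct H as [h0 [h1 [e [He [_ H]]]]].
  apply reduced_nondegenerate in H; trivial.
  (* [t = 1] means [rho = 0], and [-1 < t < 0] means [-2 < e * rho < -1]. *)
  - destruct He as [-> | ->]; unfold Rabs; destruct (Rcase_abs rho); lra.
  - apply powerRZ_m1_cases.
  - apply Rmult_le_pos; lra.
  - apply Rmult_le_pos; lra.
  - intros E; apply Hd; unfold degenerate.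
    apply (Rmult_eq_reg_l (a * b)).
    + lra.
    + apply Rgt_not_eq, Rmult_lt_0_compat; assumption. }
(* The values [t = 0, 1, -1] correspond to [e * rho = -1, 0, -2]. The case [rho = 0] does occur:
   [x0 = x1 = 0] with [psi = a * b] is a solution there. *)
assert (Hdeg : forall x0 x1 psi n,
  is_solution (a ^ 2) (b ^ 2) ds rho x0 x1 psi n -> degenerate x0 x1 ->
  rho = 0 \/ Rabs rho = 1 \/ Rabs rho = 2).
{ intros x0 x1 psi n H Hd.
  apply solution_reduced in H; trivial.
  destruct H as [h0 [h1 [e [He [_ H]]]]].
  apply reduced_degenerate in H; trivial.
  - destruct He as [-> | ->]; unfold Rabs; destruct (Rcase_abs rho); lra.
  - apply powerRZ_m1_cases.
  - apply Rmult_le_pos; lra.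
  - apply Rmult_le_pos; lra.
  - unfold degenerate in Hd.
    replace (a * x0 * (b * x1)) with (a * b * (x0 * x1)) by ring.
    rewrite Hd; ring. }
split; [split|split].
- intros [x0 [x1 [psi [n [H Hd]]]]]. now apply (Hnondeg x0 x1 psi n).
- intros Hrho.
  (* Taking [e] opposite in sign to [rho] gives [t = 1 - Rabs rho], which turns the condition on
     [rho] into the one on [t]. *)
  assert (He : exists e, (e = 1 \/ e = -1)
            /\ (1 + e * rho = 1 \/ -1 < 1 + e * rho < 0)).
  { unfold Rabs in Hrho; destruct (Rcase_abs rho) as [h|h];
      [exists 1|exists (-1)]; lra. }
  destruct He as [e [He Ht]].
  destruct (reduced_exists _ _ HK Ht) as [n [u [Hu H]]].
  assert (Hx : 0 < u / a) by now apply Rdiv_lt_0_compat.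
  assert (Hy : 0 < u / b) by now apply Rdiv_lt_0_compat.
  (* These undo the rescaling, so that [a * x0 = b * x1 = u]. *)
  exists (u / a), (u / b), (a * b * Rabs (1 + e * rho)), n; split.
  + apply solution_reduced; trivial. do 2 (split; [lra|]).
    exists e; split; [|split]; trivial.
    replace (a * (u / a)) with u by (field; lra).
    replace (b * (u / b)) with u by (field; lra).
    exact H.
  + unfold degenerate. now apply Rgt_not_eq, Rmult_lt_0_compat.
- intros Hrho x0 x1 psi n H.
  destruct (Req_dec (x0 * x1) 0) as [|Hd]; [assumption|exfalso].
  destruct (Hnondeg _ _ _ _ H Hd) as [E|E]; [|lra].
  rewrite E, Rabs_R0 in Hrho; lra.
- intros Hrho [x0 [x1 [psi [n H]]]]; apply Hrho.
  destruct (Req_dec (x0 * x1) 0) as [Hd|Hd].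
  + destruct (Hdeg _ _ _ _ H Hd); tauto.
  + destruct (Hnondeg _ _ _ _ H Hd); tauto.
Qed.
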